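(* Let $\|\cdot\|$ be a norm on $\mathbb R^d$ with dual norm $\|\cdot\|_\ast$. Assume that, almost surely, $f_\xi$ is convex and $L$-smooth with respect to $\|\cdot\|$ ($L>0$), that $\psi$ satisfies the interior condition stated in the context, and that $\psi$ is $\mu_\psi$-strongly convex over $\mathcal X$ with respect to $\|\cdot\|$ ($\mu_\psi>0$). Let $c\ge1$, $\eta_b>0$, and let $(x_t)_{t\ge1}$ be the iterates of stochastic mirror descent with the stepsizes $$\eta_t=\min\left\{\frac{\mu_\psi\,(f_{\xi_t}(x_t)-f_{\xi_t}^\ast)}{c\,\|\nabla f_{\xi_t}(x_t)\|_\ast^2},\ \eta_b\right\}.$$ Then for every $x_\ast\in\mathcal X_\ast$ and every $t\ge1$, with $\bar x_t=\frac1t\sum_{s=1}^tx_s$, $$\mathbb E\left[f(\bar x_t)-f(x_\ast)\right]\le\frac{2B_\psi(x_\ast;x_1)}{\alpha t}+\frac{2\eta_b\sigma^2}{\alpha},\qquad\text{where }\alpha=\min\left\{\frac{\mu_\psi}{2cL},\eta_b\right\}.$$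
   Context: Setting. $\mathcal X\subseteq\mathbb R^d$ is a nonempty closed convex set (possibly unbounded), $\psi:\mathcal D\to\mathbb R$ is a convex function, differentiable on $\operatorname{int}\mathcal D$, with $\mathcal X\subseteq\mathcal D\subseteq\mathbb R^d$. $\xi$ is a random vector supported on a set $\Xi$; $f_\xi:\mathbb R^d\to\mathbb R$ is differentiable, $f(x)=\mathbb E_\xi[f_\xi(x)]$ is well defined and differentiable, and $\mathbb E_\xi[\nabla f_\xi(x)]=\nabla f(x)$ for each $x\in\mathcal X$; all expectations involved are assumed well defined. $\mathcal X_\ast$ is the set of minimizers of $f$ over $\mathcal X$, assumed nonempty. Bregman divergence: $B_h(x;y)=h(x)-h(y)-\langle\nabla h(y),x-y\rangle$. A function $h$ is $L$-smooth with respect to $\|\cdot\|$ if $B_h(x;y)\le\frac L2\|x-y\|^2$ for all $x,y\in\mathbb R^d$. $\psi$ is $\mu_\psi$-strongly convex over $\mathcal X$ with respect to $\|\cdot\|$ if $\frac{\mu_\psi}2\|x-y\|^2\le B_\psi(x;y)$ for all $(x,y)\in\mathcal X\times(\mathcal X\cap\operatorname{int}\mathcal D)$. The dual norm is $\|x\|_\ast=\sup\{\langle x,y\rangle:\|y\|\le1\}$. Interior condition on $\psi$: for every $x_t\in\mathcal X\cap\operatorname{int}\mathcal D$, every vector $g$ and every stepsize $\eta_t>0$, the point $x_{t+1}=\arg\min_{x\in\mathcal X}\{\langle g,x\rangle+\frac1{\eta_t}B_\psi(x;x_t)\}$ exists and lies in $\operatorname{int}\mathcal D$. Stochastic mirror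 descent: $x_1\in\mathcal X\cap\operatorname{int}\mathcal D$ is deterministic, $\xi_1,\xi_2,\dots$ are i.i.d. copies of $\xi$, and $x_{t+1}=\arg\min_{x\in\mathcal X}\{\langle\nabla f_{\xi_t}(x_t),x\rangle+\frac1{\eta_t}B_\psi(x;x_t)\}$. Convention: if $\nabla f_{\xi_t}(x_t)=0$, take $\eta_t=\eta_b$ (the update then gives $x_{t+1}=x_t$). $f_\xi^\ast=\inf_{x\in\mathbb R^d}f_\xi(x)$, and $\sigma^2=f(x_\ast)-\mathbb E_\xi[f_\xi^\ast]$ for $x_\ast\in\mathcal X_\ast$, assumed $<\infty$. *)

(* Defs.v *)
(* MathComp-Analysis; R^d is 'rV[R]_d. *)
From HB Require Import structures.
From mathcomp Require Import all_boot all_order all_algebra finmap.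
From mathcomp Require Import all_classical all_reals all_analysis.

Set Implicit Arguments.
Unset Strict Implicit.
Unset Printing Implicit Defensive.

Import Order.TTheory GRing.Theory Num.Theory.
Import numFieldNormedType.Exports.

Local Open Scope classical_set_scope.
Local Open Scope ring_scope.

Section deterministic.
Context {R : realType} {d : nat}.
Implicit Types (x y g : 'rV[R]_d) (h psi N : 'rV[R]_d -> R).

Definition dot x y : R := \sum_(i < d) x 0 i * y 0 i.

(* The vector of partial derivatives; only used at points where h is
   differentiable. *)
Definition grad h x : 'rV[R]_d := \row_(i < d) 'D_(delta_mx 0 i) h x.

(* The library norm `|x| on 'rV[R]_d is the sup norm, used here only as a
   carrier of the topology; an arbitrary norm is a separate function N. *)
Definition is_norm N :=
  [/\ forall x, N x = 0 -> x = 0,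
      forall (a : R) x, N (a *: x) = `|a| * N x &
      forall x y, N (x + y) <= N x + N y].

Definition dual_norm N x : R := sup [set dot x y | y in [set y | N y <= 1]].

Definition bregman h x y : R := h x - h y - dot (grad h y) (x - y).

Definition smooth N (L : R) h :=
  forall x y, bregman h x y <= L / 2 * N (x - y) ^+ 2.

Definition strongly_convex_over (X D : set 'rV[R]_d) N (mu : R) psi :=
  forall x y, X x -> (X `&` D°) y -> mu / 2 * N (x - y) ^+ 2 <= bregman psi x y.

Definition is_argmin (X : set 'rV[R]_d) h x :=
  X x /\ forall y, X y -> h x <= h y.

(* The function x |-> <g, x> + B_psi(x; y) / eta. *)
Definition md_objective psi g (eta : R) y x : R :=
  dot g x + eta^-1 * bregman psi x y.

Definition interior_condition (X D : set 'rV[R]_d) psi :=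
  forall y g (eta : R), (X `&` D°) y -> 0 < eta ->
    exists2 z, is_argmin X (md_objective psi g eta y) z & D° z.

End deterministic.

Section stochastic.
Context {R : realType} {d : nat} {dS : measure_display} {S : measurableType dS}.
Implicit Types (f : S -> 'rV[R]_d -> R) (Q : probability S R).

(* Throughout, Q is the law of xi on the space S of its values, so that the
   expectation of g(xi) is 'E_Q[g]. *)
Definition objective f Q (x : 'rV[R]_d) : R := fine 'E_Q[f ^~ x].

(* The infimum of f s, which is -oo if f s is unbounded below. *)
Definition finf f (s : S) : \bar R := ereal_inf (range (fun x => (f s x)%:E)).

Definition sigma2 f Q (x : 'rV[R]_d) : \bar R :=
  ((objective f Q x)%:E - \int[Q]_s finf f s)%E.

(* The minimum is taken in \bar R, so that the stepsize is eta_b on the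
   negligible set where finf f s = -oo. *)
Definition stepsize (N : 'rV[R]_d -> R) (mu c eta_b : R) f s x : R :=
  let g := grad (f s) x in
  if g == 0 then eta_b else
  fine (mine (mu%:E * ((f s x)%:E - finf f s) / (c * dual_norm N g ^+ 2)%:E)
             eta_b%:E)%E.

Context {dO : measure_display} {Omega : measurableType dO}.
Implicit Types P : probability Omega R.

Definition mutually_independent P (I : set nat) (X : nat -> {RV P >-> S}) :=
  forall (J : {fset nat}) (A : nat -> set S),
    [set` J] `<=` I -> (forall j, measurable (A j)) ->
    P (\bigcap_(j in [set` J]) (X j @^-1` A j))
    = (\prod_(j <- J) P (X j @^-1` A j))%E.

(* xi 1, xi 2, ... are independent with law Q; index 0 is not used. *)
Definition iid_copies P Q (xi : nat -> {RV P >-> S}) :=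
  mutually_independent [set t | (0 < t)%N] xi /\
  forall t, (0 < t)%N -> forall A, measurable A -> distribution P (xi t) A = Q A.

(* Time starts at 1: x 1 is the starting point and x 0 is not used. *)
Definition smd_iterates (X : set 'rV[R]_d) psi f (x1 : 'rV[R]_d)
    (eta : S -> 'rV[R]_d -> R) (xi : nat -> Omega -> S)
    (x : nat -> Omega -> 'rV[R]_d) :=
  (forall w, x 1%N w = x1) /\
  forall t, (0 < t)%N -> forall w,
    is_argmin X
      (md_objective psi (grad (f (xi t w)) (x t w)) (eta (xi t w) (x t w))
         (x t w))
      (x t.+1 w).

Definition average_iterate (x : nat -> Omega -> 'rV[R]_d) (t : nat) w :=
  t%:R^-1 *: \sum_(1 <= s < t.+1) x s w.

End stochastic.

(* Main.v *)
(* Write f_t = f_(xi_t), m_t = inf f_t and g_t = grad f_t(x_t), with dual norm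
   r_t. For a minimizer xs, optimality of x_(t+1), strong convexity of psi and
   AM-GM give
     eta_t <g_t, x_t - xs>
       <= B(xs; x_t) - B(xs; x_(t+1)) + eta_t^2 r_t^2 / (2 mu).
   The stepsize bounds the last term by half of eta_t (f_t(x_t) - m_t), and
   smoothness gives alpha <= eta_t <= eta_b, so that by convexity
     alpha/2 (f_t(x_t) - m_t)
       <= B(xs; x_t) - B(xs; x_(t+1)) + eta_b (f_t(xs) - m_t).
   Both gaps are nonnegative; summing and taking expectations gives the bound.
   Replacing E[f_t(x_t)] by E[f(x_t)] is Tonelli's theorem for the independent
   pair (past, xi_t). It needs x_t to be a measurable function of the past: the
   mirror step is a minimization whose unique solution is a Lipschitz function of
   eta_t g_t - grad psi(x_t). *)
Require Import Defs.
From HB Require Import structures.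
From mathcomp Require Import all_boot all_order all_algebra finmap.
From mathcomp Require Import all_classical all_reals all_analysis.
From mathcomp Require Import measurable_realfun.
From mathcomp Require Import ring lra.

Set Implicit Arguments.
Unset Strict Implicit.
Unset Printing Implicit Defensive.

Import Order.TTheory GRing.Theory Num.Theory.
Import numFieldNormedType.Exports.

Local Open Scope classical_set_scope.
Local Open Scope ring_scope.

(** * Gradients and the mirror step *)

Section euclidean.
Context {R : realType} {d : nat}.
Implicit Types (x y z g v : 'rV[R]_d) (h psi N : 'rV[R]_d -> R).

Lemma dotDl x y z : dot (x + y) z = dot x z + dot y z.
Proof. by rewrite /dot -big_split; apply: eq_bigr => i _; rewrite mxE mulrDl. Qed.

Lemma dotDr x y z : dot x (y + z) = dot x y + dot x z.
Proof. by rewrite /dot -big_split; apply: eq_bigr => i _; rewrite mxE mulrDr. Qed.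

Lemma dotZl (a : R) x y : dot (a *: x) y = a * dot x y.
Proof. by rewrite /dot mulr_sumr; apply: eq_bigr => i _; rewrite mxE mulrA. Qed.

Lemma dotZr (a : R) x y : dot x (a *: y) = a * dot x y.
Proof. by rewrite /dot mulr_sumr; apply: eq_bigr => i _; rewrite mxE mulrCA. Qed.

Lemma dotNl x y : dot (- x) y = - dot x y.
Proof. by rewrite -scaleN1r dotZl mulN1r. Qed.

Lemma dotNr x y : dot x (- y) = - dot x y.
Proof. by rewrite -scaleN1r dotZr mulN1r. Qed.

Lemma dotBl x y z : dot (x - y) z = dot x z - dot y z.
Proof. by rewrite dotDl dotNl. Qed.

Lemma dotBr x y z : dot x (y - z) = dot x y - dot x z.
Proof. by rewrite dotDr dotNr. Qed.

Lemma dot0l y : dot 0 y = 0.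
Proof. by rewrite -(scale0r 0) dotZl mul0r. Qed.

Lemma dot0r x : dot x 0 = 0.
Proof. by rewrite -(scale0r 0) dotZr mul0r. Qed.

Lemma dot_sumr (I : Type) (r : seq I) x (y : I -> 'rV[R]_d) :
  dot x (\sum_(i <- r) y i) = \sum_(i <- r) dot x (y i).
Proof. exact: (big_morph (dot x) (dotDr x) (dot0r x)). Qed.

Lemma dot_self_gt0 x : x != 0 -> 0 < dot x x.
Proof.
move=> x0; rewrite lt_def sumr_ge0 ?andbT; last first.
  by move=> i _; rewrite -expr2 sqr_ge0.
apply: contra x0 => /eqP xx; apply/eqP/rowP => i; rewrite mxE.
have := psumr_eq0P _ xx; move=> /(_ _ i isT) H.
by apply/eqP; rewrite -sqrf_eq0 expr2 H// => j _; rewrite -expr2 sqr_ge0.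
Qed.

Lemma norm_coord_le x i : `|x 0 i| <= `|x|.
Proof.
rewrite [X in _ <= X]/Num.Def.normr /= mx_normrE.
by apply/bigmax_geP; right; exists (0, i).
Qed.

Lemma norm_le_coord x (r : R) : 0 <= r -> (forall i, `|x 0 i| <= r) -> `|x| <= r.
Proof.
move=> r0 xr; rewrite [X in X <= _]/Num.Def.normr /= mx_normrE.
by apply/bigmax_leP; split=> // -[i j] _ /=; rewrite ord1.
Qed.

Lemma normr_dot_le x y : `|dot x y| <= d%:R * (`|x| * `|y|).
Proof.
rewrite (le_trans (ler_norm_sum _ _ _))//.
rewrite mulr_natl -[X in _ *+ X]card_ord -sumr_const ler_sum// => i _.
by rewrite normrM ler_pM// norm_coord_le.
Qed.

Lemma dot_gradE h x v : differentiable h x -> dot (grad h x) v = 'D_v h x.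
Proof.
move=> hx; rewrite deriveE// [in RHS](row_sum_delta v) linear_sum /dot.
by apply: eq_bigr => i _; rewrite linearZ mxE deriveE//= mulrC.
Qed.

(** The sequential form, with steps [n.+1%:R^-1], serves both for limits of inequalities and for the
    measurability of gradients. *)
Lemma derive_cvg_seq h x v : differentiable h x ->
  (fun n => n.+1%:R * (h (x + n.+1%:R^-1 *: v) - h x)) @ \oo --> 'D_v h x.
Proof.
move=> hx.
have : (fun t : R => t^-1 *: ((h \o shift x) (t *: v) - h x)) @ 0^' --> 'D_v h x.
  exact: diff_derivable.
move/cvgr_dnbhsP => /(_ (fun n => n.+1%:R^-1 : R)) H.
have -> : (fun n => n.+1%:R * (h (x + n.+1%:R^-1 *: v) - h x)) =
  (fun n => n.+1%:R^-1^-1 *: ((h \o shift x) (n.+1%:R^-1 *: v) - h x)).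
  by apply/funext => n; rewrite invrK /= [_ *: v + x]addrC.
by apply: H; split=> //; exact: cvg_harmonic.
Qed.

(** Increments are compared for [0 < t <= 1] only, so the bound applies along a segment that stays
    in a convex set. *)
Lemma derive_ge h x v (K : R) : differentiable h x ->
  (forall t : R, 0 < t -> t <= 1 -> t * K <= h (x + t *: v) - h x) ->
  K <= 'D_v h x.
Proof.
move=> hx H; have cv := derive_cvg_seq (v := v) hx.
rewrite -(cvg_lim _ cv)//; apply: limr_ge; first exact: cvgP cv.
apply: nearW => n; rewrite -ler_pdivrMl//; apply: H => //.
by rewrite invf_le1// ler1n.
Qed.

Lemma conv_lineE x y (t : R) (t0 : 0 <= t) (t1 : t <= 1) :
  conv (Itv01 t0 t1) (y : convex_lmodType 'rV[R]_d) x = x + t *: (y - x).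
Proof.
rewrite [LHS](_ : _ = t *: y + (1 - t) *: x)//.
by rewrite scalerBr scalerBl scale1r addrCA.
Qed.

Lemma convex_first_order h x y : convex_function setT h -> differentiable h x ->
  h x + dot (grad h x) (y - x) <= h y.
Proof.
move=> hcvx hx; rewrite dot_gradE//.
(* [derive_ge] bounds derivatives from below, so it is applied to [- h]; convexity controls the
   increments along the segment to [y]. *)
suff : h x - h y <= 'D_(y - x) (- h) x.
  rewrite deriveN; last exact: diff_derivable.
  by set r := 'D_ _ _ _; lra.
apply: derive_ge => [|t t0 t1]; first exact: differentiableN.
have := hcvx (Itv01 (ltW t0) t1) y x (in_setT _) (in_setT _).
rewrite conv_lineE [X in _ <= X -> _](_ : _ = t * h y + (1 - t) * h x)// !fctE.
lra.
Qed.

(** Turns the gradient term of the optimality condition into differences of divergences, which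
    telescope along the iterates. *)
Lemma three_point psi x y z :
  dot (grad psi z - grad psi y) (x - z)
  = bregman psi x y - bregman psi x z - bregman psi z y.
Proof. rewrite /bregman !(dotBl, dotBr); ring. Qed.

Section mirror_step.
Variables (X D : set 'rV[R]_d) (psi N : 'rV[R]_d -> R) (mu : R).
Hypothesis Xconvex : convex_set X.
Hypothesis psi_diff : forall x, D° x -> differentiable psi x.

(** Convexity of [X] keeps the segment from [z] to [x] feasible, so the derivative of the objective
    at [z] in that direction is nonnegative; multiplying by [eta] clears the inverse stepsize. *)
Lemma md_optimality g (eta : R) y z x : 0 < eta ->
  is_argmin X (md_objective psi g eta y) z -> D° z -> X x ->
  0 <= dot (eta *: g + grad psi z - grad psi y) (x - z).
Proof.
move=> eta0 [Xz zmin] Dz Xx.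
rewrite dotBl dotDl dotZl (dot_gradE _ (psi_diff Dz)).
suff : dot (grad psi y) (x - z) - eta * dot g (x - z) <= 'D_(x - z) psi z by lra.
apply: derive_ge; first exact: psi_diff.
move=> t t0 t1.
have Xt : X (z + t *: (x - z)).
  have := Xconvex (Itv01 (ltW t0) t1) (mem_set Xx) (mem_set Xz).
  by rewrite inE conv_lineE.
have := zmin _ Xt; rewrite /md_objective /bregman !(dotBr, dotDr, dotZr).
rewrite -(ler_pM2l eta0) !mulrDr !mulrA divff ?gt_eqF// !mul1r.
lra.
Qed.

Hypothesis N_norm : is_norm N.
Hypothesis mu0 : 0 < mu.
Hypothesis psi_sconvex : strongly_convex_over X D N mu psi.

(** First-order optimality at the interior minimizer [z], combined with strong convexity, forces
    [N (z' - z) = 0]. *)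
Lemma md_argmin_unique g (eta : R) y z z' : 0 < eta ->
  is_argmin X (md_objective psi g eta y) z -> D° z ->
  is_argmin X (md_objective psi g eta y) z' -> z' = z.
Proof.
move=> eta0 argz Dz [Xz' z'min].
have := md_optimality eta0 argz Dz Xz'.
rewrite -addrA dotDl dotZl three_point dotBr.
have [Xz zmin] := argz.
have h2 := psi_sconvex Xz' (conj Xz Dz).
have := z'min _ Xz.
rewrite /md_objective -(ler_pM2l eta0) !mulrDr !mulrA divff ?gt_eqF// !mul1r.
move=> h1 h3.
have [N0 _ _] := N_norm.
have : mu / 2 * N (z' - z) ^+ 2 <= 0 by rewrite /bregman in h2 h3; lra.
rewrite pmulr_rle0 ?divr_gt0// => h4.
have /eqP : N (z' - z) ^+ 2 = 0 by apply/eqP; rewrite eq_le h4 sqr_ge0.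
by rewrite sqrf_eq0 => /eqP/N0/eqP; rewrite subr_eq0 => /eqP.
Qed.

End mirror_step.

End euclidean.

(** * Dual norms and stepsizes *)

Section norms.
Context {R : realType} {d : nat}.
Implicit Types (x y z g v : 'rV[R]_d) (h psi : 'rV[R]_d -> R).
Variable N : 'rV[R]_d -> R.
Hypothesis N_norm : is_norm N.

Let N_triangle x y : N (x + y) <= N x + N y. Proof. by case: N_norm. Qed.

Let N_scale (a : R) x : N (a *: x) = `|a| * N x. Proof. by case: N_norm. Qed.

Lemma is_norm0 : N 0 = 0.
Proof. by rewrite -(scale0r 0) N_scale normr0 mul0r. Qed.

Lemma is_normN x : N (- x) = N x.
Proof. by rewrite -scaleN1r N_scale normrN1 mul1r. Qed.

Lemma is_norm_ge0 x : 0 <= N x.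
Proof.
have := N_triangle x (- x); rewrite subrr is_norm0 is_normN; lra.
Qed.

Lemma is_norm_ub : exists2 K : R, 0 < K & forall x, N x <= K * `|x|.
Proof.
(* The summand 1 keeps the constant positive also for [d = 0]. *)
exists (1 + \sum_i N (delta_mx 0 i)) => [|x].
  by rewrite ltr_wpDr// sumr_ge0// => i _; exact: is_norm_ge0.
rewrite mulrDl mul1r mulr_suml.
apply: (@le_trans _ _ (\sum_i N (delta_mx 0 i) * `|x|)); last by rewrite lerDr.
rewrite {1}(row_sum_delta x).
elim/big_ind2: _ => [|u a w b ua wb|i _]; first by rewrite is_norm0.
- by rewrite (le_trans (N_triangle _ _))// lerD.
- by rewrite N_scale mulrC ler_wpM2l ?is_norm_ge0// norm_coord_le.
Qed.

Lemma is_norm_continuous : continuous N.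
Proof.
have [K K0 NK] := is_norm_ub.
move=> x; apply/(@cvgrPdist_lt _ _ _ (nbhs x)) => e e0.
near=> y.
have h1 := N_triangle (x - y) y.
have h2 := N_triangle (y - x) x.
rewrite !subrK -opprB is_normN in h1 h2.
have : N (y - x) < e.
  rewrite (le_lt_trans (NK _))// -ltr_pdivlMl// distrC mulrC.
  by near: y; apply: cvgr_dist_lt => //; exact: divr_gt0.
rewrite ltr_norml; lra.
Unshelve. all: by end_near. Qed.

(** By compactness [N] attains a minimum on the unit sphere of the sup norm, and homogeneity extends
    the bound to all vectors. *)
Lemma is_norm_lb : exists2 K : R, 0 < K & forall x, K * `|x| <= N x.
Proof.
pose A := [set x : 'rV[R]_d | `|x| = 1].
(* If the sphere is empty, every vector is zero; this happens for [d = 0]. *)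
have [A0|A0] := pselect (A !=set0); last first.
  exists 1 => // x; rewrite mul1r.
  have [->|x0] := eqVneq x 0; first by rewrite normr0 is_norm0.
  exfalso; apply: A0; exists (`|x|^-1 *: x).
  by rewrite /A /= normrZ normfV normr_id mulVf// normr_eq0.
have cA : compact A.
  apply: bounded_closed_compact.
    by exists 1; split => // M M1 x /= ->; exact: ltW.
  rewrite (_ : A = (fun x : 'rV[R]_d => `|x|) @^-1` [set 1])//.
  apply: preimage_closed; last exact: closed_eq.
  by move=> x _; exact: norm_continuous.
have [|u uA umin] := @EVT_min_rV R d N A A0 cA.
  by apply: continuous_subspaceT; exact: is_norm_continuous.
have uA1 : `|u| = 1 by move: uA; rewrite inE.
exists (N u).
  rewrite lt_def is_norm_ge0 andbT; apply/eqP => Nu0.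
  have [N0 _ _] := N_norm.
  by move: uA1; rewrite (N0 _ Nu0) normr0 => /esym/eqP; rewrite oner_eq0.
move=> x; have [->|x0] := eqVneq x 0; first by rewrite normr0 mulr0 is_norm0.
have /umin : `|x|^-1 *: x \in A.
  by rewrite inE /A /= normrZ normfV normr_id mulVf// normr_eq0.
rewrite N_scale normfV normr_id => H.
by rewrite -ler_pdivlMr ?normr_gt0// mulrC.
Qed.

Lemma dual_norm_le g (r : R) : (forall v, N v <= 1 -> dot g v <= r) ->
  dual_norm N g <= r.
Proof.
move=> H; apply: ge_sup => [|_ [v vN <-]]; last exact: H.
by exists (dot g 0); exists 0 => //=; rewrite is_norm0.
Qed.

(** Makes [dual_norm] a genuine supremum: [sup] takes the default value 0 on an unbounded set. *)
Lemma dual_norm_has_ubound g : has_ubound [set dot g v | v in [set v | N v <= 1]].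
Proof.
have [K K0 KN] := is_norm_lb.
exists (d%:R * (`|g| * K^-1)) => _ [v /= Nv <-].
rewrite (le_trans (ler_norm _))// (le_trans (normr_dot_le _ _))//.
rewrite !ler_wpM2l// -[leRHS]mulr1 ler_pdivlMl//.
exact: le_trans (KN v) Nv.
Qed.

Lemma dual_norm_ge g v : N v <= 1 -> dot g v <= dual_norm N g.
Proof.
by move=> Nv; apply: (ub_le_sup (dual_norm_has_ubound g)); exists v.
Qed.

Lemma dual_norm_ge0 g : 0 <= dual_norm N g.
Proof.
have := @dual_norm_ge g 0; rewrite is_norm0 => /(_ ler01).
by rewrite dot0r.
Qed.

Lemma dot_le_dual_norm g v : dot g v <= dual_norm N g * N v.
Proof.
have [v0|v0] := eqVneq (N v) 0.
  have [N0 _ _] := N_norm.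
  by rewrite v0 (N0 _ v0) dot0r mulr0.
have Nv : 0 < N v by rewrite lt_def v0 is_norm_ge0.
rewrite -ler_pdivrMr// mulrC -dotZr dual_norm_ge// N_scale ger0_norm ?mulVf//.
by rewrite invr_ge0 ltW.
Qed.

Lemma dual_norm_gt0 g : g != 0 -> 0 < dual_norm N g.
Proof.
move=> g0; rewrite lt_def dual_norm_ge0 andbT; apply/eqP => r0.
have := dot_le_dual_norm g g; rewrite r0 mul0r.
have := dot_self_gt0 g0; lra.
Qed.

(** The linear forms in the supremum are uniformly Lipschitz in [g]. This makes the dual norm of a
    random gradient measurable. *)
Lemma dual_norm_lipschitz : exists2 K : R, 0 < K &
  forall g g', `|dual_norm N g - dual_norm N g'| <= K * `|g - g'|.
Proof.
have [K K0 KN] := is_norm_lb.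
have H g g' : dual_norm N g <= dual_norm N g' + (d%:R * K^-1 + 1) * `|g - g'|.
  apply: dual_norm_le => v Nv.
  rewrite -[X in dot X v](subrK g') addrC dotDl lerD ?dual_norm_ge//.
  rewrite (le_trans (ler_norm _))// (le_trans (normr_dot_le _ _))//.
  rewrite mulrDl mul1r -[leLHS]addr0 lerD//.
  rewrite -mulrA ler_wpM2l// [leRHS]mulrC ler_wpM2l// -[leRHS]mulr1 ler_pdivlMl//.
  exact: le_trans (KN v) Nv.
exists (d%:R * K^-1 + 1).
  by rewrite ltr_wpDl// mulr_ge0// invr_ge0 ltW.
move=> g g'; rewrite ler_norml.
have h1 := H g g'; have := H g' g; rewrite distrC => h2.
by apply/andP; split; lra.
Qed.

(** The value at [x - t *: v], with [N v <= 1], is at least [m], and by smoothness at most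
    [h x - t * dot g v + L / 2 * t ^+ 2]. The supremum over [v] turns this into a bound on [r]. *)
Lemma smooth_dual_norm (L m : R) h x : 0 < L -> smooth N L h ->
  (forall y, m <= h y) -> dual_norm N (grad h x) ^+ 2 <= 2 * L * (h x - m).
Proof.
move=> L0 hL hm; set g := grad h x; set r := dual_norm N g.
have [->|r0] := eqVneq r 0.
  by rewrite expr0n/= mulr_ge0 ?subr_ge0// mulr_ge0// ltW.
have {}r0 : 0 < r by rewrite lt_def r0 dual_norm_ge0.
(* This [t] minimizes [L / 2 * t ^+ 2 - t * r]. *)
pose t := r / L; have t0 : 0 < t by exact: divr_gt0.
suff : r <= t^-1 * (h x - m + L / 2 * t ^+ 2).
  rewrite ler_pdivlMl// /t => H.
  have -> : 2 * L * (h x - m) = 2 * L * (h x - m + L / 2 * (r / L) ^+ 2) - r ^+ 2.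
    by field; exact: lt0r_neq0.
  have : 2 * L * (r / L * r) <= 2 * L * (h x - m + L / 2 * (r / L) ^+ 2).
    by rewrite ler_wpM2l// mulr_ge0// ltW.
  have -> : 2 * L * (r / L * r) = 2 * r ^+ 2 by field; exact: lt0r_neq0.
  lra.
apply: dual_norm_le => v Nv; rewrite ler_pdivlMl//.
have := hL (x - t *: v) x; have := hm (x - t *: v).
rewrite /bregman (_ : x - t *: v - x = - (t *: v)); last by rewrite addrAC subrr add0r.
rewrite dotNr dotZr is_normN N_scale gtr0_norm//.
rewrite exprMn -/g => h1 h2.
have : L / 2 * (t ^+ 2 * N v ^+ 2) <= L / 2 * t ^+ 2.
  apply: ler_wpM2l; first by rewrite divr_ge0// ltW.
  rewrite -[leRHS]mulr1 ler_wpM2l ?sqr_ge0//.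
  by rewrite expr_le1// is_norm_ge0.
lra.
Qed.

End norms.

Section mirror_descent_step.
Context {R : realType} {d : nat}.
Implicit Types (x y z g v : 'rV[R]_d).
Variables (X D : set 'rV[R]_d) (psi N : 'rV[R]_d -> R) (mu : R).
Hypothesis Xconvex : convex_set X.
Hypothesis psi_diff : forall x, D° x -> differentiable psi x.
Hypothesis N_norm : is_norm N.
Hypothesis mu0 : 0 < mu.
Hypothesis psi_sconvex : strongly_convex_over X D N mu psi.

(** The inner product is split at [z]: optimality and [three_point] handle [z - x], while duality
    and strong convexity handle the displacement [y - z]. *)
Lemma md_step_le g (eta : R) y z x : 0 < eta -> (X `&` D°) y ->
  is_argmin X (md_objective psi g eta y) z -> D° z -> X x ->
  eta * dot g (y - x) <= bregman psi x y - bregman psi x z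
    + eta ^+ 2 * dual_norm N g ^+ 2 / (2 * mu).
Proof.
move=> eta0 XDy zmin Dz Xx; have [Xz _] := zmin.
have := md_optimality Xconvex psi_diff eta0 zmin Dz Xx.
rewrite -addrA dotDl dotZl three_point.
have := psi_sconvex Xz XDy.
have := dot_le_dual_norm N_norm g (y - z).
rewrite -[X in dual_norm N g * X](is_normN N_norm) opprB.
set n := N (z - y); set r := dual_norm N g => h1 h2 h3.
(* Completing the square in [n]. *)
have h4 : eta * (r * n) - mu / 2 * n ^+ 2 <= eta ^+ 2 * r ^+ 2 / (2 * mu).
  rewrite -subr_ge0 (_ : _ - _ = (eta * r - mu * n) ^+ 2 / (2 * mu)).
    by rewrite divr_ge0 ?sqr_ge0// mulr_ge0// ltW.
  by field; exact: lt0r_neq0.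
have : eta * dot g (y - z) <= eta * (r * n) by rewrite ler_wpM2l// ltW.
rewrite !dotBr in h3 *; lra.
Qed.

End mirror_descent_step.

Section stepsize_bounds.
Context {R : realType} {d : nat} {dS : measure_display} {S : measurableType dS}.
Implicit Types (x y : 'rV[R]_d).
Variables (f : S -> 'rV[R]_d -> R) (N : 'rV[R]_d -> R) (mu c eta_b : R).
Hypothesis N_norm : is_norm N.
Hypothesis mu0 : 0 < mu.
Hypothesis c1 : 1 <= c.
Hypothesis eta_b0 : 0 < eta_b.

Lemma finf_le s x : (finf f s <= (f s x)%:E)%E.
Proof. by apply: ereal_inf_lbound; exists x. Qed.

(** At a point attaining the infimum the derivative along minus the gradient would be nonnegative,
    yet it is minus the squared Euclidean length of the gradient. *)
Lemma finf_lt s x : differentiable (f s) x -> grad (f s) x != 0 ->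
  (finf f s < (f s x)%:E)%E.
Proof.
move=> fx g0; rewrite lt_neqAle finf_le andbT; apply/eqP => fE.
have : 0 <= 'D_(- grad (f s) x) (f s) x.
  apply: derive_ge => // t _ _; rewrite mulr0 subr_ge0 -lee_fin -fE.
  exact: finf_le.
rewrite -dot_gradE// dotNr; have := dot_self_gt0 g0; lra.
Qed.

Let stepsize_den s x : grad (f s) x != 0 ->
  0 < c * dual_norm N (grad (f s) x) ^+ 2.
Proof.
move=> g0; rewrite mulr_gt0 ?exprn_gt0 ?dual_norm_gt0//.
exact: lt_le_trans c1.
Qed.

Lemma stepsizeE s x (m : R) : grad (f s) x != 0 -> finf f s = m%:E ->
  stepsize N mu c eta_b f s x
  = Num.min (mu * (f s x - m) / (c * dual_norm N (grad (f s) x) ^+ 2)) eta_b.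
Proof.
move=> g0 fm; rewrite /stepsize (negbTE g0) fm.
by rewrite -EFinB -EFinM inver gt_eqF ?stepsize_den// -EFinM -EFin_min.
Qed.

(** For a nonzero gradient the denominator is positive, so the first argument of the minimum is
    [+oo]. *)
Lemma stepsize_infty s x : finf f s = -oo%E -> stepsize N mu c eta_b f s x = eta_b.
Proof.
move=> fm; rewrite /stepsize; case: ifPn => // g0; rewrite fm.
rewrite /= inver gt_eqF ?stepsize_den// gt0_muley ?lte_fin//.
rewrite gt0_mulye ?lte_fin ?invr_gt0 ?stepsize_den//.
Qed.

Lemma finf_neq_pinfty s : finf f s != +oo%E.
Proof.
by have := finf_le s 0; case: (finf f s).
Qed.

(** Holds for every [s], not only almost surely, so that [interior_condition] applies to every
    outcome. *)
Lemma stepsize_gt0 s x : differentiable (f s) x -> 0 < stepsize N mu c eta_b f s x.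
Proof.
move=> fx; have [g0|g0] := eqVneq (grad (f s) x) 0.
  by rewrite /stepsize g0 eqxx.
have := finf_neq_pinfty s; case fs : (finf f s) => [m| |] // _; last first.
  by rewrite stepsize_infty.
rewrite (stepsizeE g0 fs) lt_min eta_b0 andbT divr_gt0 ?stepsize_den//.
by rewrite mulr_gt0// subr_gt0 -lte_fin -fs finf_lt.
Qed.

Variable s : S.
Variable m : R.
Hypothesis fsm : finf f s = m%:E.

Lemma stepsize_le_eta_b x : stepsize N mu c eta_b f s x <= eta_b.
Proof.
have [g0|g0] := eqVneq (grad (f s) x) 0; first by rewrite /stepsize g0 eqxx.
by rewrite (stepsizeE g0 fsm) ge_min lexx orbT.
Qed.

(** Read off the first argument of the minimum, where [1 <= c] allows dropping [c]; a zero gradient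
    has dual norm 0. *)
Lemma stepsize_dual_norm_le x :
  stepsize N mu c eta_b f s x * dual_norm N (grad (f s) x) ^+ 2
  <= mu * (f s x - m).
Proof.
have fm : 0 <= f s x - m by rewrite subr_ge0 -lee_fin -fsm finf_le.
have [g0|g0] := eqVneq (grad (f s) x) 0.
  rewrite g0; have -> : dual_norm N 0 = 0.
    apply/eqP; rewrite eq_le dual_norm_ge0// andbT.
    by apply: dual_norm_le => // v _; rewrite dot0l.
  by rewrite expr0n mulr0 mulr_ge0// ltW.
have r0 := dual_norm_gt0 N_norm g0.
rewrite (stepsizeE g0 fsm).
apply: (@le_trans _ _ (mu * (f s x - m) / c)); last first.
  rewrite ler_pdivrMr ?(lt_le_trans _ c1)// ler_peMr// mulr_ge0//.
  exact: ltW.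
rewrite -ler_pdivlMr ?exprn_gt0// ge_min -[X in X <= _]mulrA.
by rewrite -!mulrA -invfM lexx.
Qed.

(** [smooth_dual_norm], with [m] the infimum, bounds the first argument of the minimum below by
    [mu / (2 * c * L)]. *)
Lemma stepsize_ge (L : R) x : 0 < L -> smooth N L (f s) ->
  Num.min (mu / (2 * c * L)) eta_b <= stepsize N mu c eta_b f s x.
Proof.
move=> L0 fL.
have [g0|g0] := eqVneq (grad (f s) x) 0.
  by rewrite /stepsize g0 eqxx ge_min lexx orbT.
rewrite (stepsizeE g0 fsm) le_min !ge_min lexx !orbT andbT.
have c0 : 0 < c by exact: lt_le_trans c1.
rewrite ler_pdivlMr ?stepsize_den// mulrAC ler_pdivrMr ?mulr_gt0//.
have -> : mu * (f s x - m) * (2 * c * L) = mu * c * (2 * L * (f s x - m)) by ring.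
rewrite (mulrA mu c) ler_wpM2l//; first by rewrite mulr_ge0// ltW.
apply: smooth_dual_norm => // y.
by rewrite -lee_fin -fsm finf_le.
Qed.

Variables (X D : set 'rV[R]_d) (psi : 'rV[R]_d -> R) (L : R).
Hypothesis Xconvex : convex_set X.
Hypothesis psi_diff : forall x, D° x -> differentiable psi x.
Hypothesis psi_sconvex : strongly_convex_over X D N mu psi.
Hypothesis L0 : 0 < L.
Hypothesis fs_convex : convex_function setT (f s).
Hypothesis fs_smooth : smooth N L (f s).

Lemma smd_step_le x y z : differentiable (f s) y -> (X `&` D°) y ->
  is_argmin X
    (md_objective psi (grad (f s) y) (stepsize N mu c eta_b f s y) y) z ->
  D° z -> X x ->
  Num.min (mu / (2 * c * L)) eta_b / 2 * (f s y - m)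
  <= bregman psi x y - bregman psi x z + eta_b * (f s x - m).
Proof.
move=> fy XDy zmin Dz Xx.
have eta0 := stepsize_gt0 fy.
have := md_step_le Xconvex psi_diff N_norm mu0 psi_sconvex eta0 XDy zmin Dz Xx.
have := stepsize_dual_norm_le y; have := stepsize_ge y L0 fs_smooth.
have := stepsize_le_eta_b y.
set eta := stepsize _ _ _ _ _ _ _ in eta0 zmin *.
set al := Num.min _ _; set r2 := dual_norm _ _ ^+ 2 => h1 h2 h3.
have h4 := convex_first_order x fs_convex fy.
have ge_m u : 0 <= f s u - m by rewrite subr_ge0 -lee_fin -fsm finf_le.
(* [stepsize_dual_norm_le] turns the quadratic error into half of the scaled gap at [y]. *)
have h5 : eta ^+ 2 * r2 / (2 * mu) <= eta / 2 * (f s y - m).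
  rewrite ler_pdivrMr ?mulr_gt0//.
  have -> : eta / 2 * (f s y - m) * (2 * mu) = eta * (mu * (f s y - m)) by field.
  by rewrite expr2 -mulrA ler_wpM2l// ltW.
have h6 : eta * (f s y - f s x) <= eta * dot (grad (f s) y) (y - x).
  apply: ler_wpM2l; first exact: ltW.
  by rewrite !dotBr in h4 *; lra.
have h7 : al / 2 * (f s y - m) <= eta / 2 * (f s y - m).
  by rewrite ler_wpM2r// ler_wpM2r.
have h8 : eta * (f s x - m) <= eta_b * (f s x - m) by rewrite ler_wpM2r.
(* With [f s y - f s x] written as a difference of gaps over [m], one half of the gap at [y] pays
   for [h5] and the other half remains. *)
move=> h9.
lra.
Qed.

End stepsize_bounds.

(** * Measurability of the mirror step *)

Section row_measurability.
Context {R : realType} {d : nat} {dT : measure_display} {T : measurableType dT}.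
Implicit Types (x y z g v : 'rV[R]_d) (u : T -> 'rV[R]_d).

(** Coordinatewise measurability stands for Borel measurability of a random vector. *)
Definition row_measurable u := forall i, measurable_fun setT (fun w => u w 0 i).

Lemma row_measurable_cst x : row_measurable (fun=> x).
Proof. by move=> i; exact: measurable_cst. Qed.

Lemma row_measurableD u u' : row_measurable u -> row_measurable u' ->
  row_measurable (fun w => u w + u' w).
Proof.
move=> mu mu' i; under eq_fun do rewrite mxE.
by apply: measurable_funD; [exact: mu|exact: mu'].
Qed.

Lemma row_measurableZ (a : T -> R) u : measurable_fun setT a ->
  row_measurable u -> row_measurable (fun w => a w *: u w).
Proof.
move=> ma mu i; under eq_fun do rewrite mxE.
by apply: measurable_funM; [exact: ma|exact: mu].
Qed.

Lemma row_measurable_sum (I : Type) (r : seq I) (u : I -> T -> 'rV[R]_d) :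
  (forall j, row_measurable (u j)) -> row_measurable (fun w => \sum_(j <- r) u j w).
Proof.
move=> mu; elim: r => [|j r IH].
  by under eq_fun do rewrite big_nil; exact: row_measurable_cst.
by under eq_fun do rewrite big_cons; exact: row_measurableD.
Qed.

(* [corner n (cell n x)] takes countably many values and tends to [x]; this
   replaces simple functions, as ['rV[R]_d] carries no sigma-algebra here. *)
Definition cell (n : nat) x : 'rV[int]_d := \row_i Num.floor (n.+1%:R * x 0 i).

Definition corner (n : nat) (k : 'rV[int]_d) : 'rV[R]_d :=
  \row_i ((k 0 i)%:~R / n.+1%:R).

Lemma cell_dist n x y : cell n x = cell n y -> `|x - y| <= n.+1%:R^-1.
Proof.
move=> xy; apply: norm_le_coord => // i; rewrite !mxE.
have /rowP/(_ i) := xy; rewrite !mxE => fxy.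
have := floor_itv (n.+1%:R * x 0 i); have := floor_itv (n.+1%:R * y 0 i).
rewrite fxy intrD1 => /andP[h1 h2] /andP[h3 h4].
rewrite -[leRHS]mulr1 ler_pdivlMl//.
rewrite -[X in X * _](@ger0_norm _ n.+1%:R)// -normrM mulrBr ler_norml.
apply/andP; split; lra.
Qed.

Lemma corner_dist n x : `|corner n (cell n x) - x| <= n.+1%:R^-1.
Proof.
(* The floor of an integer is itself, so the corner lies in the cell of [x]. *)
apply: cell_dist; apply/rowP => i; rewrite !mxE.
by rewrite mulrC divfK// intrKfloor.
Qed.

Lemma corner_cvg x : corner n (cell n x) @[n --> \oo] --> x.
Proof.
apply/(@cvgrPdist_lt _ _ _ \oo) => e e0; near=> n.
rewrite distrC (le_lt_trans (corner_dist _ _))//.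
near: n; exact: (near_infty_natSinv_lt (PosNum e0)).
Unshelve. all: by end_near. Qed.

Lemma measurable_cell u n k : row_measurable u ->
  measurable [set w | cell n (u w) = k].
Proof.
move=> mu.
rewrite (_ : [set w | _] = \bigcap_(i in [set: 'I_d])
   ((fun w => n.+1%:R * u w 0 i) @^-1` `[(k 0 i)%:~R, (k 0 i + 1)%:~R[%classic)).
  (* The intersection over coordinates is treated as the complement of a countable union. *)
  rewrite -[X in measurable X]setCK setC_bigcap; apply: measurableC.
  apply: countable_bigcupT_measurable => [|i]; first exact: countableP.
  apply: measurableC; rewrite -[X in measurable X]setTI.
  by apply: measurable_funM => //; exact: mu.
apply/seteqP; split => w /=.
  move=> <- i _ /=; rewrite in_itv /= mxE; exact: floor_itv.
move=> H; apply/rowP => i; rewrite mxE; apply/eqP; rewrite floor_eq.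
by have := H i I; rewrite /= in_itv.
Qed.

(** The cells split [T] into countably many measurable pieces, on each of which the condition is a
    fixed [B k]. *)
Lemma measurable_preimage_cells u (n : nat)
    (B : 'rV[int]_d -> set T) : row_measurable u -> (forall k, measurable (B k)) ->
  measurable [set w | B (cell n (u w)) w].
Proof.
move=> mu mB.
rewrite (_ : [set w | _] = \bigcup_k ([set w | cell n (u w) = k] `&` B k)).
  apply: countable_bigcupT_measurable => [|k]; first exact: countableP.
  by apply: measurableI => //; exact: measurable_cell.
apply/seteqP; split => [w Bw|w [k _ [/= <-]]]//.
by exists (cell n (u w)).
Qed.

(** Replacing [u] by its grid corners leaves countably many measurable sections [h ^~ x]; continuity
    in [x] gives the pointwise limit. *)
Lemma measurable_caratheodory (h : T -> 'rV[R]_d -> R) u :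
  (forall x, measurable_fun setT (h ^~ x)) -> (forall w, continuous (h w)) ->
  row_measurable u -> measurable_fun setT (fun w => h w (u w)).
Proof.
move=> hm hc um.
apply: (@measurable_fun_cvg _ _ _ _ (fun n w => h w (corner n (cell n (u w))))).
  move=> n _ Y mY; rewrite setTI.
  apply: (@measurable_preimage_cells u n
    (fun k => [set w | Y (h w (corner n k))])) => // k.
  by rewrite -[X in measurable X]setTI; exact: hm.
move=> w _; apply: continuous_cvg; first exact: hc.
exact: corner_cvg.
Qed.

(** An open set is the union of the grid cells it contains, over all mesh sizes. *)
Lemma measurable_preimage_open u (U : set 'rV[R]_d) : open U ->
  row_measurable u -> measurable (u @^-1` U).
Proof.
move=> oU um.
rewrite (_ : _ @^-1` _ = \bigcup_n
  [set w | [set _ | cell n @^-1` [set cell n (u w)] `<=` U] w]).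
  apply: bigcup_measurable => n _.
  apply: (@measurable_preimage_cells u n
    (fun k => [set _ | cell n @^-1` [set k] `<=` U])) => // k.
  (* The condition on the cell does not involve [w], so the set is everything or empty. *)
  have [kU|kU] := pselect (cell n @^-1` [set k] `<=` U).
    by rewrite (_ : [set _ | _] = setT)//; apply/seteqP; split.
  by rewrite (_ : [set _ | _] = set0)//; apply/seteqP; split.
apply/seteqP; split => [w /= Uw|w [n _ /=]]; last exact.
have /nbhs_ballP[e /= e0 eU] : nbhs (u w) U by exact: open_nbhs_nbhs.
have [n ne] : exists n, n.+1%:R^-1 < e.
  near \oo => n; exists n; near: n; exact: (near_infty_natSinv_lt (PosNum e0)).
exists n => // x /= xw; apply: eU; rewrite -ball_normE /=.
by rewrite (le_lt_trans _ ne)// cell_dist.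
Unshelve. all: by end_near. Qed.

(* [phi] is a continuous function of [u] on [E]; its domain [u @` E] need not be
   measurable. *)
Lemma measurable_fun_factor u (E : set T) (phi : T -> R) : row_measurable u ->
  (forall w, E w -> forall e : R, 0 < e -> exists2 r : R, 0 < r &
    forall w', E w' -> `|u w' - u w| < r -> `|phi w' - phi w| < e) ->
  measurable_fun E phi.
Proof.
move=> um H mE; apply: (measurability _ (RGenOInfty.measurableE R)) => //.
move=> _ [_ [a ->] <-].
(* [V] is the union of the balls such that [a < phi w] whenever [E w] and [u w] lies in the ball. It
   is open, and its preimage agrees on [E] with the set where [a < phi]. *)
pose V := \bigcup_(p in [set p : 'rV[R]_d * R | 0 < p.2 /\
   forall w, E w -> ball p.1 p.2 (u w) -> a < phi w]) ball p.1 p.2.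
rewrite (_ : E `&` _ = E `&` u @^-1` V).
  apply: measurableI => //; apply: measurable_preimage_open um.
  by apply: bigcup_open => -[x r] [/= r0 _]; exact: ball_open.
apply/seteqP; split => w [Ew /=]; rewrite ?in_itv/= ?andbT.
  move=> aw; split => //.
  have [|r r0 rH] := H _ Ew (phi w - a); first by rewrite subr_gt0.
  exists (u w, r) => /=; last exact: ballxx.
  split => // w' Ew'; rewrite -ball_normE /= distrC => /(rH _ Ew').
  by rewrite ltr_norml; lra.
by move=> [[x r] [/= r0]] rw xw; split => //=; rewrite ?in_itv /= ?andbT; exact: rw.
Qed.

Lemma measurable_fun_continuous_within u (E : set T)
    (h : 'rV[R]_d -> R) :
  row_measurable u -> (forall w, E w -> {for u w, continuous h}) ->
  measurable_fun E (h \o u).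
Proof.
move=> um hc; apply: measurable_fun_factor um _ => w Ew e e0.
have /(@cvgrPdist_lt _ _ _ (nbhs (u w))) /(_ _ e0) := hc _ Ew.
move=> /nbhs_ballP[r /= r0 rH]; exists r => // w' _ ww'.
by rewrite distrC; apply: rH; rewrite -ball_normE /= distrC.
Qed.

(** Partial derivatives are limits of difference quotients, each measurable by
    [measurable_caratheodory]. *)
Lemma row_measurable_grad (h : T -> 'rV[R]_d -> R) u :
  (forall x, measurable_fun setT (h ^~ x)) ->
  (forall w x, differentiable (h w) x) ->
  row_measurable u -> row_measurable (fun w => grad (h w) (u w)).
Proof.
move=> hm hd um i; under eq_fun do rewrite mxE.
apply: (@measurable_fun_cvg _ _ _ _ (fun n w =>
  n.+1%:R * (h w (u w + n.+1%:R^-1 *: delta_mx 0 i) - h w (u w)))).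
  have hc w : continuous (h w).
    by move=> x; exact: differentiable_continuous.
  move=> n; apply: measurable_funM => //; apply: measurable_funB.
    apply: measurable_caratheodory hm hc _.
    exact: row_measurableD um (row_measurable_cst _).
  exact: measurable_caratheodory hm hc um.
by move=> w _; exact: derive_cvg_seq.
Qed.

(** The shifted point of a difference quotient may leave [U], so the quotients use [psi] extended by
    0 outside [U]. *)
Lemma row_measurable_grad_open (psi : 'rV[R]_d -> R) (U : set 'rV[R]_d) u :
  open U -> (forall x, U x -> differentiable psi x) ->
  (forall w, U (u w)) ->
  row_measurable u -> row_measurable (fun w => grad psi (u w)).
Proof.
move=> oU psid uU um i; under eq_fun do rewrite mxE.
have patch_meas (v : T -> 'rV[R]_d) : row_measurable v ->
    measurable_fun setT (fun w => (psi \_ U) (v w)).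
  move=> vm; rewrite (_ : (fun _ => _) = (psi \o v) \_ (v @^-1` U)).
    apply/(measurable_restrictT _ (measurable_preimage_open oU vm)).
    apply: measurable_fun_continuous_within => // w /= Uw.
    exact: differentiable_continuous (psid _ Uw).
  by apply/funext.
apply: (@measurable_fun_cvg _ _ _ _ (fun n w => n.+1%:R *
  ((psi \_ U) (u w + n.+1%:R^-1 *: delta_mx 0 i) - (psi \_ U) (u w)))).
  move=> n; apply: measurable_funM => //; apply: measurable_funB.
    exact: patch_meas (row_measurableD um (row_measurable_cst _)).
  exact: patch_meas.
(* As [U] is open, the shifted point lies in [U] for large [n], and the quotients are then those of
   [psi]. *)
move=> w _; have /= := derive_cvg_seq (v := delta_mx 0 i) (psid _ (uU w)).
apply: cvg_trans; apply: near_eq_cvg; near=> n.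
rewrite /patch (mem_set (uU w)) ifT//; apply/mem_set.
near: n.
have : (fun n => u w + n.+1%:R^-1 *: (delta_mx 0 i : 'rV[R]_d)) @ \oo --> u w.
  rewrite -[X in _ --> X]addr0 -[X in _ + X](scale0r (delta_mx 0 i)).
  apply: cvgD; first exact: cvg_cst.
  by apply: cvgZr_tmp; exact: cvg_harmonic.
by apply; exact: open_nbhs_nbhs.
Unshelve. all: by end_near. Qed.

End row_measurability.

(** * Measurability of the infimum, the stepsize and the mirror step *)

Section step_measurability.
Context {R : realType} {d : nat} {dS : measure_display} {S : measurableType dS}.
Variables (f : S -> 'rV[R]_d -> R).
Hypothesis f_meas : forall x, measurable_fun setT (f ^~ x).
Hypothesis f_diff : forall s (x : 'rV[R]_d), differentiable (f s) x.

Let f_cont s : continuous (f s).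
Proof. by move=> x; exact: differentiable_continuous. Qed.

(** By continuity the infimum may be taken over the countable dense set of grid corners. *)
Lemma measurable_finf : measurable_fun setT (finf f).
Proof.
(* [q] enumerates the corners of all grids; codes that decode to nothing give 0. *)
pose q (j : nat) : 'rV[R]_d :=
  if (@choice.unpickle (nat * 'rV[int]_d)%type j) is Some nk
  then corner nk.1 nk.2 else 0.
rewrite (_ : finf f = fun s => einfs ((fun j t => (f t (q j))%:E) ^~ s) 0).
  apply: measurable_fun_einfs => j; apply/measurable_EFinP; exact: f_meas.
apply/funext => s; apply/eqP; rewrite eq_le; apply/andP; split.
  by apply: ereal_inf_le_tmp => _ [j _ <-]; exists (q j).
apply: le_ereal_inf_tmp => _ [x _ <-].
have fc : (f s (corner n (cell n x)))%:E @[n --> \oo] --> (f s x)%:E.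
  apply: cvg_EFin; first exact: nearW.
  by apply: continuous_cvg; [exact: f_cont|exact: corner_cvg].
rewrite -(cvg_lim _ fc)//; apply: lime_ge; first exact: cvgP fc.
apply: nearW => n; apply: ereal_inf_lbound.
exists (choice.pickle (n, cell n x)) => //.
by rewrite /q choice.pickleK.
Qed.

Context {dT : measure_display} {T : measurableType dT}.

Lemma measurable_dual_norm (N : 'rV[R]_d -> R) (u : T -> 'rV[R]_d) :
  is_norm N -> row_measurable u -> measurable_fun setT (fun w => dual_norm N (u w)).
Proof.
move=> N_norm um; have [K K0 KN] := dual_norm_lipschitz N_norm.
apply: measurable_fun_factor um _ => w _ e e0.
exists (e / K) => [|w' _]; first exact: divr_gt0.
rewrite ltr_pdivlMr// mulrC; exact: le_lt_trans.
Qed.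

Lemma measurable_stepsize (N : 'rV[R]_d -> R) (mu c eta_b : R)
    (s : T -> S) (u : T -> 'rV[R]_d) : is_norm N -> 1 <= c ->
  measurable_fun setT s -> row_measurable u ->
  measurable_fun setT (fun w => stepsize N mu c eta_b f (s w) (u w)).
Proof.
move=> N_norm c1 sm um.
have gm : row_measurable (fun w => grad (f (s w)) (u w)).
  apply: (@row_measurable_grad _ _ _ _ (fun w => f (s w))) => // x.
  exact: measurableT_comp (f_meas x) sm.
have rm := measurable_dual_norm N_norm gm.
have fm : measurable_fun setT (fun w => f (s w) (u w)).
  apply: (@measurable_caratheodory _ _ _ _ (fun w => f (s w))) => // x.
  exact: measurableT_comp (f_meas x) sm.
pose r w := dual_norm N (grad (f (s w)) (u w)).
(* The gradient and its dual norm vanish together, so the test may be made on [r]; elsewhere the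
   extended division is multiplication by a real inverse. *)
rewrite (_ : (fun w => _) = (fun w => if r w == 0 then eta_b else
   fine (mine ((mu%:E * ((f (s w) (u w))%:E - finf f (s w))) *
     ((c * r w ^+ 2)^-1)%:E) eta_b%:E)%E)); last first.
  apply/funext => w; rewrite /stepsize -/(r w).
  have [g0|g0] := eqVneq (grad (f (s w)) (u w)) 0.
    rewrite ifT// /r g0; rewrite eq_le dual_norm_ge0// andbT.
    by apply: dual_norm_le => // v _; rewrite dot0l.
  have r0 : 0 < r w by exact: dual_norm_gt0.
  rewrite (gt_eqF r0) inver gt_eqF// mulr_gt0 ?exprn_gt0//.
  exact: lt_le_trans c1.
apply: measurable_fun_ifT => //.
  exact: measurable_fun_eqr rm _.
apply: measurableT_comp => //; apply: measurable_mine => //.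
apply: emeasurable_funM.
  apply: emeasurable_funM => //; apply: emeasurable_funB.
    exact/measurable_EFinP.
  exact: measurableT_comp measurable_finf sm.
apply/measurable_EFinP.
(* The inverse is rewritten as a measurable real power; both sides are 0 at 0. *)
have rE w : (c * r w ^+ 2)^-1 = (c * r w ^+ 2) `^ (-1).
  by rewrite powR_inv1// mulr_ge0 ?sqr_ge0// (le_trans ler01).
under eq_fun do rewrite rE.
apply: (measurableT_comp (measurable_powR (-1))).
by apply: measurable_funM => //; exact: measurable_funX.
Qed.

Variables (X D : set 'rV[R]_d) (psi N : 'rV[R]_d -> R) (mu : R).
Hypothesis Xconvex : convex_set X.
Hypothesis psi_diff : forall x, D° x -> differentiable psi x.
Hypothesis N_norm : is_norm N.
Hypothesis mu0 : 0 < mu.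
Hypothesis psi_sconvex : strongly_convex_over X D N mu psi.

(* The minimizer depends on the data only through [eta *: g - grad psi y]. *)
Lemma md_argmin_lipschitz : exists2 K : R, 0 < K &
  forall (g : 'rV[R]_d) (eta : R) y z g' (eta' : R) y' z', 0 < eta -> 0 < eta' ->
  is_argmin X (md_objective psi g eta y) z -> D° z ->
  is_argmin X (md_objective psi g' eta' y') z' -> D° z' ->
  `|z - z'| <= K * `|(eta *: g - grad psi y) - (eta' *: g' - grad psi y')|.
Proof.
have [K K0 KN] := is_norm_lb N_norm.
(* The quotient comes from [normr_dot_le] and the comparison of [N] with the sup norm; adding 1
   keeps it positive for [d = 0]. *)
exists (d%:R / (mu * K ^+ 2) + 1).
  by rewrite ltr_wpDl// divr_ge0// mulr_ge0 ?sqr_ge0// ltW.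
move=> g eta y z g' eta' y' z' eta0 eta'0 zmin Dz z'min Dz'.
have [Xz _] := zmin; have [Xz' _] := z'min.
have := md_optimality Xconvex psi_diff eta0 zmin Dz Xz'.
have := md_optimality Xconvex psi_diff eta'0 z'min Dz' Xz.
have := psi_sconvex Xz (conj Xz' Dz').
have := psi_sconvex Xz' (conj Xz Dz).
set p := eta *: g - _; set p' := eta' *: g' - _.
rewrite (addrAC (eta *: g)) (addrAC (eta' *: g')) -/p -/p' /bregman.
rewrite -(is_normN N_norm (z - z')) opprB => h1 h2 h3 h4.
(* The two optimality conditions are added; the divergences between [z] and [z'] in both orders sum
   to the difference of gradients paired with [z' - z]. *)
have h5 : mu * N (z' - z) ^+ 2 <= dot (p - p') (z' - z).
  by rewrite !(dotDl, dotNl, dotDr, dotNr) in h1 h2 h3 h4 *; lra.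
have h6 := le_trans h5 (le_trans (ler_norm _) (normr_dot_le _ _)).
rewrite distrC; have [->|n0] := eqVneq `|z' - z| 0.
  by rewrite mulr_ge0// addr_ge0// divr_ge0// mulr_ge0 ?sqr_ge0// ltW.
have {}n0 : 0 < `|z' - z| by rewrite lt_def n0 normr_ge0.
have h7 : mu * (K * `|z' - z|) ^+ 2 <= mu * N (z' - z) ^+ 2.
  rewrite ler_wpM2l// ?(ltW mu0)// ler_sqr ?nnegrE ?is_norm_ge0//.
  by rewrite mulr_ge0// ltW.
have := le_trans h7 h6; rewrite exprMn (expr2 `|_|) !mulrA ler_pM2r// => h8.
rewrite mulrDl mul1r -[leLHS]addr0 lerD// mulrAC ler_pdivlMr ?mulr_gt0 ?exprn_gt0//.
by rewrite mulrC.
Qed.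

Lemma row_measurable_md_step (g u v : T -> 'rV[R]_d) (eta : T -> R) :
  row_measurable g -> measurable_fun setT eta -> row_measurable u ->
  (forall w, 0 < eta w) -> (forall w, (X `&` D°) (u w)) ->
  (forall w, is_argmin X (md_objective psi (g w) (eta w) (u w)) (v w)) ->
  (forall w, D° (v w)) -> row_measurable v.
Proof.
move=> gm em um e0 uXD vmin Dv i; have [K K0 HK] := md_argmin_lipschitz.
have pm : row_measurable (fun w => eta w *: g w - grad psi (u w)).
  apply: row_measurableD; first exact: row_measurableZ.
  under eq_fun do rewrite -scaleN1r.
  apply: row_measurableZ => //.
  apply: (@row_measurable_grad_open _ _ _ _ psi D°) => //.
    exact: open_interior.
  by move=> w; have [] := uXD w.
apply: measurable_fun_factor pm _ => w _ e e_gt0.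
exists (e / K) => [|w' _]; first exact: divr_gt0.
rewrite ltr_pdivlMr// mulrC; apply: le_lt_trans.
have := HK _ _ _ _ _ _ _ _ (e0 w') (e0 w) (vmin w') (Dv w') (vmin w) (Dv w).
apply: le_trans; have := norm_coord_le (v w' - v w) i.
by rewrite !mxE.
Qed.

End step_measurability.

(** * Independence of the past *)

Section history.
Context {R : realType} {dS dO : measure_display} {S : measurableType dS}.
Context {Omega : measurableType dO}.
Variables (P : probability Omega R) (Q : probability S R).
Variable xi : nat -> {RV P >-> S}.

(* The pi-system generating the past of the iterate [x t], which depends on
   [xi 1], ..., [xi t.-1] only. *)
Definition history (t : nat) : set (set Omega) :=
  [set A | exists2 B : nat -> set S, (forall j, measurable (B j)) &
    A = \bigcap_(j in [set j | (0 < j < t)%N]) xi j @^-1` B j].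

Lemma measurable_rv_preimage (Y : {RV P >-> S}) (B : set S) : measurable B ->
  measurable (Y @^-1` B).
Proof. by move=> mB; rewrite -[X in measurable X]setTI; exact: measurable_funP. Qed.

Lemma history_measurable t : history t `<=` measurable.
Proof.
move=> _ [B mB ->]; rewrite bigcap_mkcond; apply: bigcapT_measurable => j.
by case: ifP => // _; exact: measurable_rv_preimage.
Qed.

Lemma sigma_history_measurable t : <<s history t >> `<=` measurable.
Proof.
apply: smallest_sub; [exact: sigma_algebra_measurable|exact: history_measurable].
Qed.

Lemma history_setT t : history t setT.
Proof.
exists (fun=> setT) => //; apply/seteqP; split => // w _ j _.
Qed.

Lemma history_setI t : setI_closed (history t).
Proof.
move=> _ _ [B mB ->] [C mC ->]; exists (fun j => B j `&` C j) => [j|].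
  exact: measurableI.
by rewrite -bigcapI; apply: eq_bigcapr => j _; rewrite preimage_setI.
Qed.

Lemma history_preimage t j (B : set S) : (0 < j < t)%N -> measurable B ->
  history t (xi j @^-1` B).
Proof.
move=> jt mB; exists (fun k => if k == j then B else setT) => [k|].
  by case: ifP.
apply/seteqP; split => [w Bw k _ /=|w /(_ j jt)]; last by rewrite /= eqxx.
by case: ifP => // /eqP ->.
Qed.

Lemma history_subS t : history t `<=` history t.+1.
Proof.
move=> _ [B mB ->]; exists (fun k => if (k < t)%N then B k else setT) => [k|].
  by case: ifP.
apply/seteqP; split => w Bw k /= /andP[k0 kt].
  by case: ifP => // kt'; apply: Bw; rewrite /= k0.
have := Bw k; rewrite /= kt k0 => /(_ _); apply.
exact: ltnW.
Qed.

Hypothesis xi_iid : iid_copies Q xi.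

Lemma iid_distr t (B : set S) : (0 < t)%N -> measurable B ->
  P (xi t @^-1` B) = Q B.
Proof. by move=> t0 mB; have [_ /(_ _ t0 _ mB)] := xi_iid. Qed.

(** Both sides are finite measures in [A] that agree on the pi-system [history t], hence on the
    sigma-algebra it generates. *)
Lemma indep_history t (A : set Omega) (B : set S) : (0 < t)%N ->
  <<s history t >> A -> measurable B ->
  P (A `&` xi t @^-1` B) = (P A * Q B)%E.
Proof.
move=> t0 hA mB.
have mY := measurable_rv_preimage (xi t) mB.
have QB : Q B \is a fin_num by exact: fin_num_measure.
pose q : {nonneg R} := NngNum (fine_ge0 (measure_ge0 Q B)).
have qE X : mscale q P X = (P X * Q B)%E by rewrite /mscale /= fineK// muleC.
rewrite -qE.
transitivity (mrestr P mY A) => //.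
apply: (g_sigma_algebra_measure_unique (history t) _ (fun=> setT)) hA.
- exact: history_measurable.
- by move=> _; exact: history_setT.
- by apply/seteqP; split => // w _; exists 0%N.
- exact: history_setI.
- move=> _ [C mC ->]; rewrite [RHS]qE [LHS]/=/mrestr.
  have [ind _] := xi_iid.
  (* [J] holds the indices from 1 to [t.-1]. Independence is used on [J] with [t] added, and on [J]
     alone. *)
  pose J := [fset j in iota 1 t.-1]%fset.
  have JE : [set` J] = [set j | (0 < j < t)%N].
    by apply/seteqP; split => j /=; rewrite !inE mem_iota add1n prednK.
  have tJ : t \notin J by rewrite !inE mem_iota add1n prednK// ltnn andbF.
  pose C' j := if j == t then B else C j.
  have C'E j : j \in J -> C' j = C j.
    by move=> jJ; rewrite /C'; case: eqP => // jt; rewrite -jt jJ in tJ.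
  have tC' : C' t = B by rewrite /C' eqxx.
  transitivity (P (\bigcap_(j in [set` (t |` J)%fset]) xi j @^-1` C' j)).
    congr (P _); apply/seteqP; split => w.
      move=> [Aw Bw] j /=; rewrite in_fset1U => /orP[/eqP ->|jJ].
        by rewrite tC'.
      by rewrite C'E//; apply: Aw; rewrite -JE.
    move=> Cw; split.
      move=> j; rewrite -JE => /= jJ; rewrite -C'E//.
      by apply: Cw; rewrite /= in_fset1U jJ orbT.
    by rewrite /= -tC'; apply: Cw; rewrite /= in_fset1U eqxx.
  rewrite ind; last 2 first.
  - move=> j /=; rewrite in_fset1U => /orP[/eqP ->//|jJ].
    by have : [set` J] j by []; rewrite JE => /andP[].
  - by move=> j; rewrite /C'; case: ifP.
  rewrite big_fsetU1//= tC' (iid_distr t0 mB) muleC -JE ind//; last first.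
    by rewrite JE => j /andP[].
  congr (_ * _)%E; rewrite big_seq [RHS]big_seq.
  by apply: eq_bigr => j jJ; rewrite C'E.
- by move=> k; rewrite /= -ge0_fin_numE ?measure_ge0// fin_num_measure.
Qed.

End history.

Section independent_fubini.
Context {R : realType} {dS dO dT : measure_display} {S : measurableType dS}.
Context {Omega : measurableType dO} {T : measurableType dT}.
Variables (P : probability Omega R) (Q : probability S R).

(** Agreement on rectangles makes the joint law of [H] and [Y] a product measure, to which Tonelli's
    theorem applies. *)
Lemma ge0_integral_indep (H : {RV P >-> T}) (Y : {RV P >-> S})
    (phi : T * S -> \bar R) :
  (forall A B, measurable A -> measurable B ->
    P (H @^-1` A `&` Y @^-1` B) = (P (H @^-1` A) * Q B)%E) ->
  measurable_fun setT phi -> (forall z, 0 <= phi z)%E ->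
  (\int[P]_w phi (H w, Y w) = \int[P]_w \int[Q]_s phi (H w, s))%E.
Proof.
move=> ind mphi phi0.
have mHY : measurable_fun setT (fun w => (H w, Y w)).
  by apply: measurable_fun_pair; exact: measurable_funP.
pose HY : {RV P >-> (T * S)%type} :=
  HB.pack (fun w => (H w, Y w)) (isMeasurableFun.Build _ _ _ _ _ mHY).
transitivity (\int[distribution P HY]_z phi z)%E.
  by rewrite ge0_integral_pushforward//.
transitivity (\int[distribution P H \x Q]_z phi z)%E.
  apply: eq_measure_integral => A mA _.
  by symmetry; apply: product_measure_unique.
rewrite fubini_tonelli1// ge0_integral_pushforward//.
  exact: measurable_fun_fubini_tonelli_F.
by move=> w _; apply: integral_ge0.
Qed.

End independent_fubini.

(** By induction: the new average is a convex combination of the newest point, weighted by the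
    inverse of the number of points, and the previous average. *)
Lemma average_in_convex (R : realType) (d : nat) (X : set 'rV[R]_d)
    (y : nat -> 'rV[R]_d) (t : nat) :
  convex_set X -> (forall j, (0 < j)%N -> X (y j)) -> (0 < t)%N ->
  X (t%:R^-1 *: \sum_(1 <= j < t.+1) y j).
Proof.
move=> cX Xy; case: t => // t _; elim: t => [|t IH].
  by rewrite big_nat1 invr1 scale1r; exact: Xy.
rewrite big_nat_recr//=; set a := \sum_(_ <= _ < _) _ in IH *.
have l0 : 0 <= t.+2%:R^-1 :> R by rewrite invr_ge0.
have l1 : t.+2%:R^-1 <= 1 :> R by rewrite invf_le1// ler1n.
have := cX _ _ (Itv01 l0 l1) (mem_set (Xy t.+2 isT)) (mem_set IH).
rewrite inE conv_lineE; congr X.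
rewrite scalerBr scalerDr addrA addrAC; congr (_ + _).
rewrite scalerA -scalerBl; congr (_ *: _).
rewrite -[t.+2%:R]natr1; field.
have ht : 0 <= t%:R :> R by [].
by apply/andP; split; rewrite gt_eqF//; lra.
Qed.

(** * Expected gaps and regret *)

Section suboptimality.
Context {R : realType} {d : nat} {dS : measure_display} {S : measurableType dS}.
Variables (f : S -> 'rV[R]_d -> R) (Q : probability S R).
Hypothesis f_meas : forall x, measurable_fun setT (f ^~ x).
Hypothesis f_diff : forall s (x : 'rV[R]_d), differentiable (f s) x.
Implicit Types x y : 'rV[R]_d.

(* With values in [\bar R] the gap is nonnegative even where [finf f s = -oo], so
   Tonelli applies without exceptional sets. *)
Definition gap s y : \bar R := ((f s y)%:E - finf f s)%E.

Lemma gap_ge0 s y : (0 <= gap s y)%E.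
Proof.
rewrite /gap; have := finf_le f s y; case: (finf f s) => [m| |]//.
  by rewrite lee_fin => ?; rewrite -EFinB lee_fin subr_ge0.
by move=> _ /=; exact: leey.
Qed.

Lemma measurable_gap (dT : measure_display) (T : measurableType dT)
    (s : T -> S) (u : T -> 'rV[R]_d) :
  measurable_fun setT s -> row_measurable u ->
  measurable_fun setT (fun w => gap (s w) (u w)).
Proof.
move=> sm um; apply: emeasurable_funB.
  apply/measurable_EFinP.
  apply: (@measurable_caratheodory _ _ _ _ (fun w => f (s w))) => // [x|w x].
    exact: measurableT_comp (f_meas x) sm.
  exact: differentiable_continuous.
exact: measurableT_comp (measurable_finf f_meas f_diff) sm.
Qed.

Lemma objectiveE y : Q.-integrable setT (fun s => (f s y)%:E) ->
  (\int[Q]_s (f s y)%:E)%E = (objective f Q y)%:E.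
Proof.
by move=> fy; rewrite /objective unlock fineK// integrable_fin_num.
Qed.

(** The positive part of [finf f] is dominated by the absolute value of [f ^~ y], and an integral
    equal to [-oo] would make [sigma2] infinite. *)
Lemma integrable_finf y : Q.-integrable setT (fun s => (f s y)%:E) ->
  (sigma2 f Q y < +oo)%E -> Q.-integrable setT (finf f).
Proof.
move=> fy s2; have fm := measurable_finf f_meas f_diff.
apply/integrableP; split => //; apply/abse_integralP => //.
have fpos : (\int[Q]_s (finf f)^\+ s < +oo)%E.
  have [_] := integrableP _ _ _ fy; apply: le_lt_trans.
  apply: ge0_le_integral => //.
  - exact: measurable_funepos.
  - by apply: measurableT_comp => //; exact/measurable_EFinP.
  move=> s _; rewrite funeposE ge_max abse_ge0 andbT.
  exact: le_trans (finf_le f s y) (lee_abs _).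
have : (\int[Q]_s finf f s)%E \is a fin_num; last by rewrite fin_num_abs.
rewrite fin_real//; apply/andP; split.
  rewrite ltNye; apply: contraTN s2 => /eqP fE.
  by rewrite /sigma2 fE.
rewrite integralE (le_lt_trans _ fpos)//.
by rewrite geeDl// oppe_le0 integral_ge0.
Qed.

Hypothesis finf_int : Q.-integrable setT (finf f).

Lemma integral_gap y : Q.-integrable setT (fun s => (f s y)%:E) ->
  (\int[Q]_s gap s y)%E = (objective f Q y - fine (\int[Q]_s finf f s)%E)%:E.
Proof.
move=> fy; rewrite integralB// objectiveE// EFinB; congr (_ - _)%E.
by rewrite fineK//; exact: integrable_fin_num.
Qed.

Lemma fine_sigma2 y : sigma2 f Q y =
  (objective f Q y - fine (\int[Q]_s finf f s)%E)%:E.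
Proof.
rewrite /sigma2 EFinB; congr (_ - _)%E; rewrite fineK//.
exact: integrable_fin_num.
Qed.

Lemma finf_fin_num_ae : {ae Q, forall s, finf f s \is a fin_num}.
Proof.
have := integrable_ae measurableT finf_int.
by apply: filterS => s; exact.
Qed.

(** Jensen's inequality, obtained for almost every [s] by summing the tangent inequalities at the
    average, then integrated. *)
Lemma integral_gap_average_le (t : nat) (y : nat -> 'rV[R]_d) : (0 < t)%N ->
  {ae Q, forall s, convex_function setT (f s)} ->
  (\int[Q]_s gap s (t%:R^-1 *: \sum_(1 <= j < t.+1) y j)
   <= (t%:R^-1)%:E * \sum_(1 <= j < t.+1) \int[Q]_s gap s (y j))%E.
Proof.
move=> t0 f_cvx; set ybar := t%:R^-1 *: _.
have tr : 0 < t%:R :> R by rewrite ltr0n.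
rewrite -ge0_integral_sum//; last 2 first.
- by move=> j _; apply: measurable_gap => //; exact: row_measurable_cst.
- by move=> j s _; exact: gap_ge0.
rewrite -ge0_integralZl_EFin//; last 2 first.
- by move=> s _; apply: sume_ge0 => j _; exact: gap_ge0.
- apply: emeasurable_sum => j.
  by apply: measurable_gap => //; exact: row_measurable_cst.
apply: ae_ge0_le_integral => //.
- by move=> s _; exact: gap_ge0.
- by apply: measurable_gap => //; exact: row_measurable_cst.
- move=> s _; apply: mule_ge0; first by rewrite lee_fin invr_ge0.
  by apply: sume_ge0 => j _; exact: gap_ge0.
- apply: measurable_funeM; apply: emeasurable_sum => j.
  by apply: measurable_gap => //; exact: row_measurable_cst.
apply: filterS2 f_cvx finf_fin_num_ae => s fs fin _.
rewrite /gap -(fineK fin); set m := fine _.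
under eq_bigr do rewrite -EFinB.
rewrite sumEFin -EFinM -EFinB lee_fin ler_pdivlMl//.
have first_order j : f s ybar + dot (grad (f s) ybar) (y j - ybar) <= f s (y j).
  exact: convex_first_order.
have : \sum_(1 <= j < t.+1) (f s ybar - m + dot (grad (f s) ybar) (y j - ybar))
    <= \sum_(1 <= j < t.+1) (f s (y j) - m).
  by apply: ler_sum => j _; have := first_order j; lra.
apply: le_trans.
rewrite big_split/= sumr_const_nat subSS subn0 mulr_natl -[leLHS]addr0 lerD//.
(* The linear terms cancel, since the deviations from [ybar] sum to 0. *)
under eq_bigr do rewrite dotBr.
rewrite sumrB sumr_const_nat subSS subn0 -[X in _ - X]mulr_natl.
rewrite -dotZr /ybar scalerA divff ?scale1r ?gt_eqF//.
by rewrite dot_sumr subrr.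
Qed.

End suboptimality.

Lemma integral_probability_cst (R : realType) (dT : measure_display)
    (T : measurableType dT) (P : probability T R) (r : \bar R) :
  (\int[P]_w r)%E = r.
Proof.
rewrite integral_cst// [X in (_ * X)%E](_ : _ = 1%E) ?mule1//.
exact: probability_setT.
Qed.

(** * The iterates: interior position, measurability and regret *)

Section smd.
Context {R : realType} {d : nat} {dS dO : measure_display}.
Context {S : measurableType dS} {Omega : measurableType dO}.
Variables (X D : set 'rV[R]_d) (psi : 'rV[R]_d -> R) (f : S -> 'rV[R]_d -> R).
Variables (N : 'rV[R]_d -> R) (L mu c eta_b : R).
Variables (P : probability Omega R) (Q : probability S R).
Variables (xi : nat -> {RV P >-> S}) (x1 : 'rV[R]_d) (x : nat -> Omega -> 'rV[R]_d).
Hypothesis Xconvex : convex_set X.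
Hypothesis psi_diff : forall x : 'rV[R]_d, D° x -> differentiable psi x.
Hypothesis f_meas : forall x, measurable_fun setT (f ^~ x).
Hypothesis f_diff : forall s (x : 'rV[R]_d), differentiable (f s) x.
Hypothesis N_norm : is_norm N.
Hypothesis L0 : 0 < L.
Hypothesis psi_interior : interior_condition X D psi.
Hypothesis mu0 : 0 < mu.
Hypothesis psi_sconvex : strongly_convex_over X D N mu psi.
Hypothesis c1 : 1 <= c.
Hypothesis eta_b0 : 0 < eta_b.
Hypothesis xi_iid : iid_copies Q xi.
Hypothesis x1_in : (X `&` D°) x1.
Hypothesis x_smd : smd_iterates X psi f x1 (stepsize N mu c eta_b f) xi x.

Let alpha : R := Num.min (mu / (2 * c * L)) eta_b.

Lemma smd_alpha_gt0 : 0 < alpha.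
Proof.
rewrite lt_min eta_b0 andbT divr_gt0// mulr_gt0// mulr_gt0//.
exact: lt_le_trans c1.
Qed.

(** [smd_iterates] only asks for some minimizer; uniqueness identifies it with the interior one
    given by [psi_interior]. *)
Lemma smd_interior t w : (0 < t)%N -> (X `&` D°) (x t w).
Proof.
have [x1E x_step] := x_smd.
elim: t => // -[_ _|t IH _]; first by rewrite x1E.
have XDt := IH isT.
have argx := x_step t.+1 isT w.
have eta0 := stepsize_gt0 N_norm mu0 c1 eta_b0 (f_diff (xi t.+1 w) (x t.+1 w)).
have [z zmin Dz] := psi_interior (grad (f (xi t.+1 w)) (x t.+1 w)) XDt eta0.
have -> // : x t.+2 w = z; last by split => //; case: zmin.
exact: (md_argmin_unique Xconvex psi_diff N_norm mu0 psi_sconvex eta0 zmin Dz argx).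
Qed.

(** By induction: the step to [x t.+2] depends on [x t.+1] and the new sample [xi t.+1], both
    measurable for [history xi t.+2]. *)
Lemma smd_row_measurable_history t : (0 < t)%N ->
  @row_measurable R d _ (g_sigma_algebraType (history xi t)) (x t).
Proof.
have [x1E x_step] := x_smd.
elim: t => // -[_ _|t IH _].
  by rewrite (_ : x 1 = fun=> x1)//; exact/funext.
have um : @row_measurable R d _ (g_sigma_algebraType (history xi t.+2)) (x t.+1).
  move=> i _ B mB; have := IH isT i measurableT B mB.
  by apply: sub_sigma_algebra2; exact: history_subS.
have sm : measurable_fun [set: g_sigma_algebraType (history xi t.+2)] (xi t.+1).
  move=> _ B mB; rewrite setTI; apply: sub_sigma_algebra.
  by apply: history_preimage => //; rewrite ltnS leqnn.
have gm : @row_measurable R d _ (g_sigma_algebraType (history xi t.+2))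
    (fun w => grad (f (xi t.+1 w)) (x t.+1 w)).
  apply: (@row_measurable_grad _ _ _ (g_sigma_algebraType (history xi t.+2))
    (fun w => f (xi t.+1 w))) => // y.
  exact: measurableT_comp (f_meas y) sm.
have em := measurable_stepsize f_meas f_diff mu eta_b N_norm c1 sm um.
apply: (row_measurable_md_step Xconvex psi_diff N_norm mu0 psi_sconvex
  gm em um).
- by move=> w; exact: stepsize_gt0.
- by move=> w; exact: smd_interior.
- by move=> w; exact: x_step.
- by move=> w; case: (@smd_interior t.+2 w isT).
Qed.

Lemma history_row_measurable t (u : Omega -> 'rV[R]_d) :
  @row_measurable R d _ (g_sigma_algebraType (history xi t)) u -> row_measurable u.
Proof.
move=> um i _ B mB; have := um i measurableT B mB.
exact: sigma_history_measurable.
Qed.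

Lemma smd_row_measurable t : (0 < t)%N -> row_measurable (x t).
Proof. by move/smd_row_measurable_history/history_row_measurable. Qed.

Lemma integral_gap_history t (u : Omega -> 'rV[R]_d) : (0 < t)%N ->
  @row_measurable R d _ (g_sigma_algebraType (history xi t)) u ->
  (\int[P]_w gap f (xi t w) (u w) = \int[P]_w \int[Q]_s gap f s (u w))%E.
Proof.
move=> t0 um.
have mid : measurable_fun setT (id : Omega -> g_sigma_algebraType (history xi t)).
  by move=> _ B mB; rewrite setTI; exact: sigma_history_measurable mB.
(* The past is encoded as the identity into [Omega] with the coarser sigma-algebra generated by
   [history xi t]. *)
pose H : {RV P >-> g_sigma_algebraType (history xi t)} :=
  HB.pack (id : Omega -> g_sigma_algebraType (history xi t))
    (isMeasurableFun.Build _ _ _ _ _ mid).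
apply: (@ge0_integral_indep _ _ _ _ _ _ _ P Q H (xi t) (fun z => gap f z.2 (u z.1))).
- by move=> A B mA mB; exact: indep_history.
- apply: measurable_gap => // i.
  exact: measurableT_comp (um i) measurable_fst.
- by move=> z; exact: gap_ge0.
Qed.

Hypothesis f_convex_smooth :
  {ae Q, forall s, convex_function setT (f s) /\ smooth N L (f s)}.
Hypothesis finf_int : Q.-integrable setT (finf f).

Let good s :=
  [/\ convex_function setT (f s), smooth N L (f s) & finf f s \is a fin_num].

(** [xi t] has law [Q], so the exceptional set pulls back to a null set; countably many times are
    then combined. *)
Lemma smd_good_ae : {ae P, forall w, forall t, (0 < t)%N -> good (xi t w)}.
Proof.
have gQ : {ae Q, forall s, good s}.
  by apply: filterS2 f_convex_smooth (finf_fin_num_ae finf_int) => s [].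
apply: ae_foralln => t; have [->|t0] := posnP t; first exact: nearW.
have [A [mA QA gA]] := gQ.
exists (xi t @^-1` A); split; first exact: measurable_rv_preimage.
  by rewrite -QA; exact: iid_distr.
by move=> w /= /not_implyP[_ ngood]; exact: gA.
Qed.

Lemma smd_regret t w xs : (forall t, (0 < t)%N -> good (xi t w)) -> X xs ->
  ((alpha / 2)%:E * (\sum_(1 <= j < t.+1) gap f (xi j w) (x j w))
   <= (bregman psi xs x1)%:E
      + eta_b%:E * \sum_(1 <= j < t.+1) gap f (xi j w) xs)%E.
Proof.
move=> gw Xxs; pose m j := fine (finf f (xi j w)).
have gapE j y : (0 < j)%N -> gap f (xi j w) y = (f (xi j w) y - m j)%:E.
  by move=> j0; rewrite EFinB /m fineK//; case: (gw _ j0).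
have sumE (y : nat -> 'rV[R]_d) :
    (\sum_(1 <= j < t.+1) gap f (xi j w) (y j)
     = (\sum_(1 <= j < t.+1) (f (xi j w) (y j) - m j))%R%:E)%E.
  rewrite -sumEFin big_nat_cond [RHS]big_nat_cond.
  by apply: eq_bigr => j /andP[/andP[j0 _] _]; rewrite gapE.
rewrite (sumE (fun j => x j w)) (sumE (fun=> xs)) -!EFinM -EFinD lee_fin.
suff : alpha / 2 * \sum_(1 <= j < t.+1) (f (xi j w) (x j w) - m j) <=
    bregman psi xs x1 - bregman psi xs (x t.+1 w)
    + eta_b * \sum_(1 <= j < t.+1) (f (xi j w) xs - m j).
  have := psi_sconvex Xxs (smd_interior w (ltn0Sn t)).
  have : 0 <= mu / 2 * N (xs - x t.+1 w) ^+ 2.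
    by rewrite mulr_ge0 ?sqr_ge0// divr_ge0// ltW.
  lra.
have [x1E x_step] := x_smd.
elim: t {sumE} => [|t IH].
  by rewrite !big_nil x1E !mulr0 subrr addr0.
rewrite !(big_nat_recr t.+1)//= !mulrDr.
have [fs_cvx fs_smooth fin] := gw t.+1 isT.
have XDt := smd_interior w (ltn0Sn t).
have [_ Dt2] := smd_interior w (ltn0Sn t.+1).
have := smd_step_le N_norm mu0 c1 eta_b0 (esym (fineK fin)) Xconvex psi_diff
  psi_sconvex L0 fs_cvx fs_smooth (f_diff _ _) XDt (x_step t.+1 isT w) Dt2 Xxs.
rewrite -/alpha -/(m t.+1); lra.
Qed.

Lemma smd_expected_regret t xs : X xs ->
  (forall y, X y -> Q.-integrable setT (fun s => (f s y)%:E)) ->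
  ((alpha / 2)%:E * \sum_(1 <= j < t.+1) \int[P]_w \int[Q]_s gap f s (x j w)
   <= (bregman psi xs x1)%:E + (eta_b * t%:R)%:E * sigma2 f Q xs)%E.
Proof.
move=> Xxs f_int.
have gap_meas j (u : Omega -> 'rV[R]_d) : row_measurable u ->
    measurable_fun setT (fun w => gap f (xi j w) (u w)).
  by move=> um; apply: measurable_gap.
have xm j : measurable_fun setT (fun w => gap f (xi j.+1 w) (x j.+1 w)).
  by apply: gap_meas; exact: smd_row_measurable.
have xsm j : measurable_fun setT (fun w => gap f (xi j.+1 w) xs).
  by apply: gap_meas; exact: row_measurable_cst.
have sum_gap_ge0 w (y : nat -> 'rV[R]_d) :
    (0 <= \sum_(0 <= j < t) gap f (xi j.+1 w) (y j))%E.
  by apply: sume_ge0 => j _; exact: gap_ge0.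
(* Sums are reindexed from 0 with [j.+1], so that every time is visibly positive;
   [integral_gap_history] exchanges the expected gap for the gap at the fresh sample. *)
have sumE : (\sum_(1 <= j < t.+1) \int[P]_w \int[Q]_s gap f s (x j w)
    = \int[P]_w \sum_(0 <= j < t) gap f (xi j.+1 w) (x j.+1 w))%E.
  rewrite big_add1/= ge0_integral_sum//; last by move=> j w _; exact: gap_ge0.
  apply: eq_bigr => j _; rewrite integral_gap_history//.
  exact: smd_row_measurable_history.
(* Each expected gap at the fixed point [xs] equals [sigma2 f Q xs]. *)
have sumsE : (\int[P]_w \sum_(0 <= j < t) gap f (xi j.+1 w) xs
    = t%:R%:E * sigma2 f Q xs)%E.
  rewrite ge0_integral_sum//; last by move=> j w _; exact: gap_ge0.
  rewrite fine_sigma2// -EFinM mulr_natl.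
  rewrite (eq_bigr (fun=> (objective f Q xs - fine (\int[Q]_s finf f s)%E)%:E)).
    by rewrite sumEFin sumr_const_nat subn0.
  move=> j _; rewrite (integral_gap_history (ltn0Sn j) (row_measurable_cst xs)).
  rewrite integral_gap//; last exact: f_int.
  exact: integral_probability_cst.
have a0 : 0 <= alpha / 2 by rewrite divr_ge0// ltW// smd_alpha_gt0.
have B0 : 0 <= bregman psi xs x1.
  apply: le_trans (psi_sconvex Xxs x1_in).
  by rewrite mulr_ge0 ?sqr_ge0// divr_ge0// ltW.
rewrite sumE -ge0_integralZl_EFin//; last first.
  exact: emeasurable_sum.
rewrite (EFinM eta_b) -muleA -sumsE.
rewrite -ge0_integralZl_EFin//; last 2 first.
- exact: emeasurable_sum.
- exact: ltW.
rewrite -[X in (_ <= X + _)%E](integral_probability_cst P).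
have sumsm := emeasurable_sum (index_iota 0 t) xsm.
have sum_ge0 w : (0 <= eta_b%:E * \sum_(0 <= j < t) gap f (xi j.+1 w) xs)%E.
  by apply: mule_ge0 => //; rewrite lee_fin ltW.
rewrite -ge0_integralD//; last exact: measurable_funeM.
apply: ae_ge0_le_integral => //.
- by move=> w _; apply: mule_ge0; rewrite ?lee_fin.
- by apply: measurable_funeM; exact: emeasurable_sum.
- by move=> w _; rewrite adde_ge0// lee_fin.
- by apply: emeasurable_funD => //; exact: measurable_funeM.
apply: filterS smd_good_ae => w gw _.
by have := smd_regret t gw Xxs; rewrite !big_add1.
Qed.

End smd.

Theorem theorem7 (R : realType) (d : nat)
  (X D : set 'rV[R]_d) (psi : 'rV[R]_d -> R)
  (X0 : X !=set0) (Xclosed : closed X) (Xconvex : convex_set X)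
  (XD : X `<=` D) (Dconvex : convex_set D)
  (psi_convex : convex_function D psi)
  (psi_diff : forall x : 'rV[R]_d, D° x -> differentiable psi x)
  (* the random function f_xi, where xi has law Q *)
  (dS : measure_display) (S : measurableType dS) (Q : probability S R)
  (f : S -> 'rV[R]_d -> R)
  (f_meas : forall x, measurable_fun setT (f ^~ x))
  (f_diff : forall s (x : 'rV[R]_d), differentiable (f s) x)
  (f_int : forall x, X x ->
     \forall y \near x, Q.-integrable setT (fun s => (f s y)%:E))
  (F_diff : forall x, X x -> differentiable (objective f Q) x)
  (F_grad : forall x, X x -> forall i,
     'E_Q[fun s => grad (f s) x 0%R i]%E = (grad (objective f Q) x 0 i)%:E)
  (argmin0 : is_argmin X (objective f Q) !=set0)
  (sigma2_fin : forall xs, is_argmin X (objective f Q) xs ->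
     (sigma2 f Q xs < +oo)%E)
  (N : 'rV[R]_d -> R) (N_norm : is_norm N)
  (L : R) (L0 : 0 < L)
  (f_convex_smooth :
     {ae Q, forall s, convex_function setT (f s) /\ smooth N L (f s)})
  (psi_interior : interior_condition X D psi)
  (mu : R) (mu0 : 0 < mu) (psi_sconvex : strongly_convex_over X D N mu psi)
  (c eta_b : R) (c1 : 1 <= c) (eta_b0 : 0 < eta_b)
  (dO : measure_display) (Omega : measurableType dO) (P : probability Omega R)
  (xi : nat -> {RV P >-> S}) (xi_iid : iid_copies Q xi)
  (x1 : 'rV[R]_d) (x1_in : (X `&` D°) x1)
  (x : nat -> Omega -> 'rV[R]_d)
  (x_smd : smd_iterates X psi f x1 (stepsize N mu c eta_b f) xi x) :
  forall xs, is_argmin X (objective f Q) xs ->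
  forall t : nat, (1 <= t)%N ->
  let alpha := Num.min (mu / (2 * c * L)) eta_b in
  ('E_P[fun w => (objective f Q (average_iterate x t w) - objective f Q xs)%R]
   <= (2 * bregman psi xs x1 / (alpha * t%:R))%:E
      + (2 * eta_b / alpha)%:E * sigma2 f Q xs)%E.
Proof.
move=> xs xs_min t t0; cbv zeta; set alpha := Num.min _ _; have [Xxs xs_le] := xs_min.
have fint y : X y -> Q.-integrable setT (fun s => (f s y)%:E).
  by move=> /f_int /nbhs_singleton.
have finf_int := integrable_finf f_meas f_diff (fint _ Xxs) (sigma2_fin _ xs_min).
have gapE y : X y -> (\int[Q]_s gap f s y
    = (objective f Q y - fine (\int[Q]_s finf f s)%E)%:E)%E.
  by move=> Xy; rewrite integral_gap//; exact: fint.
have alpha0 : 0 < alpha := smd_alpha_gt0 L0 mu0 c1 eta_b0.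
have XDx j w : (0 < j)%N -> (X `&` D°) (x j w).
  exact: smd_interior Xconvex psi_diff f_diff N_norm psi_interior mu0
    psi_sconvex c1 eta_b0 x1_in x_smd j w.
have Xx j w : (0 < j)%N -> X (x j w) by move=> j0; have [] := XDx j w j0.
have xm j : (0 < j)%N -> row_measurable (x j).
  exact: smd_row_measurable Xconvex psi_diff f_meas f_diff N_norm
    psi_interior mu0 psi_sconvex c1 eta_b0 x1_in x_smd j.
have Xavg w : X (average_iterate x t w).
  by apply: average_in_convex => // j; exact: Xx.
have Fm (u : Omega -> 'rV[R]_d) : (forall w, X (u w)) -> row_measurable u ->
    measurable_fun setT (objective f Q \o u).
  move=> Xu um; apply: (measurable_fun_continuous_within um) => w _.
  exact: differentiable_continuous (F_diff _ (Xu w)).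
have avgm : row_measurable (average_iterate x t).
  rewrite /average_iterate; apply: row_measurableZ => //.
  under eq_fun do rewrite big_add1.
  by apply: row_measurable_sum => j; exact: xm.
(* The inner integral is [objective f Q] up to a constant, and [objective f Q] is continuous at the
   points of [X]. *)
have gapm j : measurable_fun setT (fun w => \int[Q]_s gap f s (x j.+1 w))%E.
  rewrite (_ : (fun w => _) = (fun w => (objective f Q (x j.+1 w)
      - fine (\int[Q]_s finf f s)%E)%:E)).
    apply/measurable_EFinP; apply: measurable_funB => //.
    by apply: Fm => [w|]; [exact: Xx|exact: xm].
  by apply/funext => w; rewrite gapE//; exact: Xx.
have tr : 0 < t%:R :> R by rewrite ltr0n.
rewrite unlock.
apply: (@le_trans _ _ (\int[P]_w ((t%:R^-1)%:E *
    \sum_(0 <= j < t) \int[Q]_s gap f s (x j.+1 w)))%E).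
  apply: ge0_le_integral => //.
  - by move=> w _; rewrite lee_fin subr_ge0; exact: xs_le.
  - apply/measurable_EFinP; apply: measurable_funB => //; exact: Fm.
  - by apply: measurable_funeM; exact: emeasurable_sum.
  move=> w _.
  have cvx : {ae Q, forall s, convex_function setT (f s)}.
    by apply: filterS f_convex_smooth => s [].
  have := integral_gap_average_le f_meas f_diff finf_int (fun j => x j w) t0 cvx.
  rewrite [X in (_ <= _ * X)%E -> _]big_add1; apply: le_trans.
  (* The expectation of [finf f] is at most [objective f Q xs], so subtracting the latter gives the
     smaller value. *)
  rewrite (gapE _ (Xavg w)) lee_fin lerD2l lerN2 -subr_ge0 -lee_fin -gapE//.
  by apply: integral_ge0 => s _; exact: gap_ge0.
have gap0 j w : (0 <= \int[Q]_s gap f s (x j.+1 w))%E.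
  by apply: integral_ge0 => s _; exact: gap_ge0.
rewrite ge0_integralZl_EFin//; last 2 first.
- by move=> w _; exact: sume_ge0.
- exact: emeasurable_sum.
rewrite ge0_integral_sum//.
have := @smd_expected_regret _ _ _ _ _ _ X D psi f N L mu c eta_b P Q xi x1 x
  Xconvex psi_diff f_meas f_diff N_norm L0 psi_interior mu0 psi_sconvex c1
  eta_b0 xi_iid x1_in x_smd f_convex_smooth finf_int t xs Xxs fint.
rewrite big_add1/= -/alpha muleC -lee_pdivlMr ?divr_gt0// (fine_sigma2 finf_int).
set V := (\sum_(_ <= _ < _) _)%E.
move=> HV.
(* The regret bound is divided by [alpha / 2] and by [t]; the factor [t] in the noise term
   cancels. *)
apply: (@le_trans _ _ ((t%:R^-1)%:E * (((bregman psi xs x1)%:E +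
  (eta_b * t%:R)%:E * (objective f Q xs - fine (\int[Q]_s finf f s)%E)%:E)
  * ((alpha / 2)^-1)%:E))%E).
  by rewrite lee_wpmul2l// lee_fin invr_ge0 ltW.
rewrite -!EFinM -!EFinD -?EFinM lee_fin le_eqVlt; apply/orP; left; apply/eqP.
by field; rewrite !gt_eqF.
Qed.
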